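(* Let $\mu\geq 0$, let $h\in\mathcal{F}_{\mu,\infty}(\mathbb{R}^d)$, let $\{\lambda_k\}_{k\geq1}$ be a sequence of step sizes with $\lambda_k>0$, and let $\sigma\in[0,1]$. Let $w_\star\in\operatorname{argmin}_x h(x)$. For any starting point $w_0\in\mathbb{R}^d$ and any $N\geq1$, all iterates of the relatively inexact proximal minimization algorithm (defined in the context) satisfy \[h(w_N)-h(w_\star)\leq\prod_{i=1}^N\left(\frac{1+\sigma}{1+\sigma+\lambda_i\mu}\right)^2\bigl(h(w_0)-h(w_\star)\bigr).\] Furthermore, this bound is tight: for all $\mu\geq0$, all $\{\lambda_k\}_k$ with $\lambda_k\geq0$, all $\sigma\in[0,1]$, all integers $d\geq1$, all $w_0\in\mathbb{R}^d$ and all integers $N\geq1$, there exist a function $h\in\mathcal{F}_{\mu,\infty}(\mathbb{R}^d)$, a point $w_\star\in\operatorname{argmin}_x h(x)$, and iterates of the algorithm applied to $h$ from $w_0$, for which this bound is achieved with equality.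
   Context: $\|\cdot\|$ is the Euclidean norm on $\mathbb{R}^d$. For $0\leq\mu<\infty$, $\mathcal{F}_{\mu,\infty}(\mathbb{R}^d)$ denotes the set of closed, proper, $\mu$-strongly convex functions $h:\mathbb{R}^d\to\mathbb{R}\cup\{+\infty\}$ (for $\mu=0$: closed, proper, convex functions). $\partial h(x)$ is the convex subdifferential of $h$ at $x$. Relatively inexact proximal minimization algorithm: given $w_0\in\mathbb{R}^d$, step sizes $\{\lambda_k\}_{k\geq1}$ and $\sigma\in[0,1]$, iterates are any sequence $(w_k)_k$ for which there exist $v_{k+1}\in\partial h(w_{k+1})$ and error vectors $e_{k+1}\in\mathbb{R}^d$ such that, for all $k\geq0$, \[w_{k+1}=w_k-\lambda_{k+1}(v_{k+1}+e_{k+1}),\qquad \lambda_{k+1}^2\|e_{k+1}\|^2\leq\sigma^2\|w_{k+1}-w_k\|^2.\] (For $\lambda_{k+1}>0$ the last condition is $\|e_{k+1}\|^2\leq\frac{\sigma^2}{\lambda_{k+1}^2}\|w_{k+1}-w_k\|^2$.) The iterates are in general not uniquely determined. *)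

(* Defs.v *)
From mathcomp Require Import all_boot all_order all_algebra.
From mathcomp Require Import all_classical all_reals all_analysis.
Import Order.TTheory GRing.Theory Num.Theory numFieldNormedType.Exports.

Set Implicit Arguments.
Unset Strict Implicit.
Unset Printing Implicit Defensive.

Local Open Scope classical_set_scope.
Local Open Scope ring_scope.

Definition dot (R : realType) (d : nat) (x y : 'rV[R]_d) : R :=
  \sum_(i < d) x 0 i * y 0 i.

(* The library norm `|x| on 'rV[R]_d is the sup norm, not the Euclidean one
   (the two induce the same topology). *)
Definition enorm (R : realType) (d : nat) (x : 'rV[R]_d) : R :=
  Num.sqrt (dot x x).

Definition proper_fun (R : realType) (d : nat) (h : 'rV[R]_d -> \bar R) : Prop :=
  (forall x, h x != -oo%E) /\ (exists x, (h x < +oo)%E).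

Definition epigraph (R : realType) (d : nat) (h : 'rV[R]_d -> \bar R) :
    set ('rV[R]_d * R) :=
  [set p | (h p.1 <= p.2%:E)%E].

Definition closed_fun (R : realType) (d : nat) (h : 'rV[R]_d -> \bar R) : Prop :=
  closed (epigraph h).

(* mu = 0 is plain convexity.  In \bar R, 0 * +oo = 0, so the endpoints
   t = 0 and t = 1 impose nothing. *)
Definition strongly_convex (R : realType) (d : nat) (mu : R)
    (h : 'rV[R]_d -> \bar R) : Prop :=
  forall (x y : 'rV[R]_d) (t : R), 0 <= t <= 1 ->
    (h (t *: x + (1 - t) *: y)%R <=
     t%:E * h x + (1 - t)%:E * h y
       - (mu / 2 * (t * (1 - t)) * enorm (x - y)%R ^+ 2)%:E)%E.

(* The class F_{mu,oo}(R^d). *)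
Definition Fclass (R : realType) (d : nat) (mu : R)
    (h : 'rV[R]_d -> \bar R) : Prop :=
  [/\ closed_fun h, proper_fun h & strongly_convex mu h].

(* For proper h this set is empty wherever h = +oo. *)
Definition subdifferential (R : realType) (d : nat) (h : 'rV[R]_d -> \bar R)
    (x : 'rV[R]_d) : set 'rV[R]_d :=
  [set v | forall y, (h x + (dot v (y - x)%R)%:E <= h y)%E].

Definition argmin (R : realType) (d : nat) (h : 'rV[R]_d -> \bar R) :
    set 'rV[R]_d :=
  [set x | forall y, (h x <= h y)%E].

(* Step sizes are indexed from 1; lambda 0 is never used. *)
Definition inexact_prox_iterates (R : realType) (d : nat)
    (h : 'rV[R]_d -> \bar R) (lambda : nat -> R) (sigma : R)
    (w0 : 'rV[R]_d) (w : nat -> 'rV[R]_d) : Prop :=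
  w 0%N = w0 /\
  exists v e : nat -> 'rV[R]_d, forall k : nat,
    [/\ subdifferential h (w k.+1) (v k.+1),
        w k.+1 = w k - lambda k.+1 *: (v k.+1 + e k.+1) &
        lambda k.+1 ^+ 2 * enorm (e k.+1) ^+ 2
          <= sigma ^+ 2 * enorm (w k.+1 - w k) ^+ 2].

Definition rate (R : realType) (mu sigma : R) (lambda : nat -> R) (N : nat) : R :=
  \prod_(1 <= i < N.+1) ((1 + sigma) / (1 + sigma + lambda i * mu)) ^+ 2.

(* Main.v *)
Require Import Defs.
From mathcomp Require Import all_boot all_order all_algebra.
From mathcomp Require Import all_classical all_reals all_analysis.
From mathcomp Require Import ring lra.
Import Order.TTheory GRing.Theory Num.Theory numFieldNormedType.Exports.

Set Implicit Arguments.
Unset Strict Implicit.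
Unset Printing Implicit Defensive.

Local Open Scope classical_set_scope.
Local Open Scope ring_scope.

(** The bound is a contraction of one step: with tau = lambda mu / (1 + sigma),
    the gap h - h(w_star) shrinks by the factor (1 + tau)^-2, and N steps
    multiply these factors.

    For one step from w0 to w1 with subgradient v at w1, strong convexity
    bounds h(w0) and h(w_star) from below by h(w1) plus a linear and a quadratic
    term ([strongly_convex_subgradient]).  Weighting these two inequalities by
    rho^2 and 1 - rho^2, where rho = (1 + tau)^-1, produces exactly
    rho^2 (h(w0) - h(w_star)) - (h(w1) - h(w_star)) >= Q, where Q is a
    quadratic form in v, w0 - w1 and w1 - w_star.  The weights are the Lagrange multipliers of
    the worst case, in which h is the quadratic below and all inequalities are
    equalities.  The form Q is nonnegative under the error criterion, which
    says that p = lambda v lies within sigma |delta| of delta = w0 - w1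
    ([prox_step_form_ge0], where Q is scaled by 2 lambda / rho^2).

    The bound is attained by h(x) = mu/2 |x|^2.  If the error is the multiple of
    w1 - w0 allowed by the criterion with the largest norm, that is
    lambda e = sigma (w1 - w0), it slows the step down and gives
    w1 = w0 / (1 + tau), hence h(w1) = (1 + tau)^-2 h(w0). *)

(** * The Euclidean inner product *)

Section InnerProduct.
Context {R : realType} {d : nat}.
Implicit Types (x y z : 'rV[R]_d) (a : R).

Lemma dotC x y : dot x y = dot y x.
Proof. by apply: eq_bigr => i _; rewrite mulrC. Qed.

Lemma dotDl x y z : dot (x + y) z = dot x z + dot y z.
Proof.
by rewrite /dot -big_split; apply: eq_bigr => i _; rewrite mxE mulrDl.
Qed.

Lemma dotZl a x y : dot (a *: x) y = a * dot x y.
Proof. by rewrite /dot mulr_sumr; apply: eq_bigr => i _; rewrite mxE mulrA. Qed.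

Lemma dot0l y : dot 0 y = 0.
Proof. by rewrite -(scale0r y) dotZl mul0r. Qed.

Lemma dotNl x y : dot (- x) y = - dot x y.
Proof. by rewrite -scaleN1r dotZl mulN1r. Qed.

Lemma dotDr x y z : dot x (y + z) = dot x y + dot x z.
Proof. by rewrite dotC dotDl !(dotC _ x). Qed.

Lemma dotZr a x y : dot x (a *: y) = a * dot x y.
Proof. by rewrite dotC dotZl dotC. Qed.

Lemma dotNr x y : dot x (- y) = - dot x y.
Proof. by rewrite dotC dotNl dotC. Qed.

Definition dotE := (dotDl, dotDr, dotNl, dotNr, dotZl, dotZr).

Lemma dot_ge0 x : 0 <= dot x x.
Proof. by apply: sumr_ge0 => i _; rewrite -expr2 sqr_ge0. Qed.

Lemma dot_eq0 x : dot x x = 0 -> x = 0.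
Proof.
move=> /eqP; rewrite psumr_eq0 => [/allP x0|i _]; last by rewrite -expr2 sqr_ge0.
apply/rowP => i; rewrite mxE; apply/eqP.
by have := x0 i (mem_index_enum i); rewrite mulf_eq0 orbb.
Qed.

Lemma enorm_sqr x : enorm x ^+ 2 = dot x x.
Proof. by rewrite sqr_sqrtr ?dot_ge0. Qed.

Lemma dot_continuous : continuous (fun x : 'rV[R]_d => dot x x).
Proof.
apply: continuous_big => [|i _ x]; first exact: add_continuous.
have coord : continuous (fun z : 'rV[R]_d => z 0 i : R).
  exact: coord_continuous.
apply: (@continuousM R _ (fun z : 'rV[R]_d => z 0 i) (fun z => z 0 i));
  exact: coord.
Qed.

End InnerProduct.

(** * One step of the algorithm *)

Section OneStep.
Context {R : realType} {d : nat}.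
Implicit Types (p delta u v w x y : 'rV[R]_d) (mu sigma tau : R).

Lemma relative_error_dot sigma p delta :
  dot (p - delta) (p - delta) <= sigma ^+ 2 * dot delta delta ->
  dot p p + (1 - sigma ^+ 2) * dot delta delta <= 2 * dot p delta.
Proof. by rewrite !dotE (dotC delta p); lra. Qed.

(** This is the triangle inequality |p| <= |delta| + |p - delta|, squared.  For
    sigma > 0 it follows without square roots from the error criterion and
    |p - (1 + sigma) delta|^2 >= 0; for sigma = 0 the criterion forces
    p = delta. *)
Lemma relative_error_norm sigma p delta : 0 <= sigma ->
  dot (p - delta) (p - delta) <= sigma ^+ 2 * dot delta delta ->
  dot p p <= (1 + sigma) ^+ 2 * dot delta delta.
Proof.
rewrite le_eqVlt => /predU1P[<-|sigma_gt0] err.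
  suff /eqP : p - delta = 0 by rewrite subr_eq0 => /eqP ->; lra.
  by apply/dot_eq0/le_anti; rewrite dot_ge0 andbT; move: err; lra.
rewrite -(ler_pM2l sigma_gt0).
have := dot_ge0 (p - (1 + sigma) *: delta).
have := relative_error_dot err.
rewrite !dotE (dotC delta p).
by set P := dot p p; set D := dot delta delta; set X := dot p delta; nra.
Qed.

(** Completing the square in w, |p - (1 + sigma) tau w|^2 >= 0, eliminates w at
    the cost of (2 + tau) |p|^2 / (1 + sigma).  After the lower bound on
    2 <p, delta> what remains is
    (1 - sigma + tau) ((1 + sigma) |delta|^2 - |p|^2 / (1 + sigma)), whose
    second factor is nonnegative by [relative_error_norm]. *)
Lemma prox_step_form_ge0 sigma tau p delta w : 0 <= sigma <= 1 -> 0 <= tau ->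
  dot (p - delta) (p - delta) <= sigma ^+ 2 * dot delta delta ->
  0 <= 2 * dot p delta + (1 + sigma) * tau * dot delta delta
       - tau * (2 + tau) * (2 * dot p w - (1 + sigma) * tau * dot w w).
Proof.
move=> /andP[sigma_ge0 sigma_le1] tau_ge0 err.
have s_gt0 : 0 < 1 + sigma by lra.
rewrite -(pmulr_rge0 _ s_gt0).
have innb := relative_error_dot err.
have normb := relative_error_norm sigma_ge0 err.
have := dot_ge0 (p - ((1 + sigma) * tau) *: w).
rewrite !dotE (dotC w p) => young.
move: innb normb young.
set P := dot p p; set D := dot delta delta; set X := dot p delta.
set Y := dot p w; set W := dot w w => innb normb young.
have t2 : 0 <= 2 + tau by lra.
have c1 : 0 <= (1 - sigma + tau) * ((1 + sigma) ^+ 2 * D - P).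
  by apply: mulr_ge0; lra.
have c2 : 0 <= (1 + sigma) * (2 * X - (P + (1 - sigma ^+ 2) * D)).
  by apply: mulr_ge0; lra.
have c3 := mulr_ge0 t2 young.
lra.
Qed.

(** Comparing the subgradient inequality with strong convexity at
    t y + (1 - t) x and dividing by t gives the claim with mu/2 replaced by
    (1 - t) mu/2; then t tends to 0. *)
Lemma strongly_convex_subgradient mu (h : 'rV[R]_d -> \bar R) x y v (a b : R) :
  0 <= mu -> strongly_convex mu h -> subdifferential h x v ->
  h x = a%:E -> h y = b%:E ->
  a + dot v (y - x) + mu / 2 * dot (y - x) (y - x) <= b.
Proof.
move=> mu_ge0 hsc hv hx hy; set q := dot (y - x) (y - x).
have c_ge0 : 0 <= mu / 2 * q by rewrite mulr_ge0 ?divr_ge0 ?dot_ge0.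
apply/ler_addgt0Pr => e e_gt0.
have den_gt0 : 0 < mu / 2 * q + e + 1 by lra.
(* This t lies in ]0, 1] and makes the defect t * (mu / 2 * q) at most e. *)
pose t := e / (mu / 2 * q + e + 1).
have tE : t * (mu / 2 * q + e + 1) = e by rewrite /t mulfVK ?gt_eqF.
have t_gt0 : 0 < t by rewrite divr_gt0.
have t_le1 : t <= 1 by rewrite ler_pdivrMr // mul1r; lra.
have t01 : 0 <= t <= 1 by rewrite ltW.
have zE : t *: y + (1 - t) *: x - x = t *: (y - x).
  by apply/rowP => i; rewrite !mxE; ring.
have := le_trans (hv _) (hsc y x t t01).
rewrite hx hy zE enorm_sqr dotZr -!EFinM -!EFinD lee_fin -/q => key.
rewrite -(ler_pM2l t_gt0); nra.
Qed.

(** The contraction for finite values, with the two strong subgradient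
    inequalities as hypotheses.  Multiplied by (1 + tau)^2, their weights
    rho^2 and 1 - rho^2 become 1 and tau (2 + tau). *)
Lemma prox_step_real mu sigma (lam : R) w0 w1 ws v e (h0 h1 hs : R) :
  0 <= mu -> 0 < lam -> 0 <= sigma <= 1 ->
  w1 = w0 - lam *: (v + e) ->
  lam ^+ 2 * dot e e <= sigma ^+ 2 * dot (w1 - w0) (w1 - w0) ->
  h1 + dot v (w0 - w1) + mu / 2 * dot (w0 - w1) (w0 - w1) <= h0 ->
  h1 + dot v (ws - w1) + mu / 2 * dot (ws - w1) (ws - w1) <= hs ->
  h1 - hs <= ((1 + sigma) / (1 + sigma + lam * mu)) ^+ 2 * (h0 - hs).
Proof.
move=> mu_ge0 lam_gt0 sigma01 w1E err sub0 subs.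
have s_gt0 : 0 < 1 + sigma by case/andP: sigma01 => *; lra.
have lm_ge0 : 0 <= lam * mu by rewrite mulr_ge0 // ltW.
pose tau := lam * mu / (1 + sigma).
have tau_ge0 : 0 <= tau by rewrite divr_ge0 // ltW.
have tauE : (1 + sigma) * tau = lam * mu by rewrite mulrC /tau mulfVK ?gt_eqF.
clearbody tau.
have t1_gt0 : 0 < 1 + tau by lra.
have -> : (1 + sigma) / (1 + sigma + lam * mu) = (1 + tau)^-1.
  rewrite -tauE -[X in _ / (X + _)]mulr1 -mulrDr invfM mulrA.
  by rewrite divff ?mul1r ?gt_eqF.
have pE : lam *: v - (w0 - w1) = - (lam *: e).
  by rewrite w1E; apply/rowP => i; rewrite !mxE; ring.
have errp : dot (lam *: v - (w0 - w1)) (lam *: v - (w0 - w1))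
            <= sigma ^+ 2 * dot (w0 - w1) (w0 - w1).
  rewrite pE dotNl dotNr opprK dotZl dotZr mulrA -expr2.
  by rewrite -(opprB w1) dotNl dotNr opprK.
have form := prox_step_form_ge0 (w1 - ws) sigma01 tau_ge0 errp.
rewrite exprVn mulrC ler_pdivlMr ?exprn_gt0 //.
rewrite -(ler_pM2l lam_gt0).
move: form sub0 subs; rewrite tauE !dotZl -(opprB w1 ws) !dotNl !dotNr opprK.
set X := dot v (w0 - w1); set D := dot (w0 - w1) (w0 - w1).
set Y := dot v (w1 - ws); set W := dot (w1 - ws) (w1 - ws).
move=> form sub0 subs.
have q_ge0 : 0 <= lam * (tau * (2 + tau)).
  by apply: mulr_ge0 (ltW lam_gt0) (mulr_ge0 tau_ge0 _); lra.
have c0 : lam * (h1 + X + mu / 2 * D) <= lam * h0 by rewrite ler_pM2l.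
have cs := ler_wpM2l q_ge0 subs.
lra.
Qed.

Lemma prox_step mu sigma (lam : R) (h : 'rV[R]_d -> \bar R) w0 w1 ws v e :
  0 <= mu -> 0 < lam -> 0 <= sigma <= 1 ->
  proper_fun h -> strongly_convex mu h -> argmin h ws ->
  subdifferential h w1 v -> w1 = w0 - lam *: (v + e) ->
  lam ^+ 2 * enorm e ^+ 2 <= sigma ^+ 2 * enorm (w1 - w0) ^+ 2 ->
  (h w1 - h ws <=
   (((1 + sigma) / (1 + sigma + lam * mu)) ^+ 2)%:E * (h w0 - h ws))%E.
Proof.
move=> mu_ge0 lam_gt0 sigma01 [hNy [x0 hx0]] hsc hmin hv w1E.
rewrite !enorm_sqr => err.
have fin_hs : h ws \is a fin_num.
  by rewrite fin_numElt ltNye hNy (le_lt_trans (hmin x0)).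
have [hs hsE] : exists hs, h ws = hs%:E by exists (fine (h ws)); rewrite fineK.
have [h1 h1E] : exists h1, h w1 = h1%:E.
  move: (hNy w1) (hv ws); rewrite hsE.
  by case: (h w1) => [r _ _| |]//; exists r.
rewrite hsE h1E; have := hNy w0; case h0E : (h w0) => [h0| |] // _.
  rewrite -!EFinD -EFinM lee_fin.
  apply: (prox_step_real mu_ge0 lam_gt0 sigma01 w1E err).
    exact: strongly_convex_subgradient hv h1E h0E.
  exact: strongly_convex_subgradient hv h1E hsE.
(* Here h w0 = +oo; the factor is positive, so the right-hand side is +oo. *)
rewrite addye // gt0_muley ?leey // lte_fin exprn_gt0 // divr_gt0 //;
  have := mulr_ge0 (ltW lam_gt0) mu_ge0; case/andP: sigma01; lra.
Qed.

End OneStep.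

Lemma rateS (R : realType) (mu sigma : R) lambda n :
  rate mu sigma lambda n.+1 =
  ((1 + sigma) / (1 + sigma + lambda n.+1 * mu)) ^+ 2 * rate mu sigma lambda n.
Proof. by rewrite /rate big_nat_recr //= mulrC. Qed.

(** * The extremal quadratic *)

Section Quadratic.
Context {R : realType} {d : nat} (mu : R) (mu_ge0 : 0 <= mu).

Definition quadratic (x : 'rV[R]_d) : \bar R := (mu / 2 * dot x x)%:E.

Lemma quadratic_Fclass : Fclass mu quadratic.
Proof.
split.
- rewrite /closed_fun.
  have -> : epigraph quadratic =
      (fun p : 'rV[R]_d * R => p.2 - mu / 2 * dot p.1 p.1) @^-1` [set r | 0 <= r].
    by apply/seteqP; split=> p /=; rewrite /epigraph /quadratic /= lee_fin subr_ge0.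
  apply: preimage_closed (@closed_ge _ 0) => p _.
  apply: cvgB; first exact: cvg_snd.
  apply: cvgM; first exact: cvg_cst.
  apply: (@cvg_comp _ _ _ fst (fun x : 'rV[R]_d => dot x x)); first exact: cvg_fst.
  exact: dot_continuous.
- by split=> [x //|]; exists 0; rewrite ltry.
- move=> x y t _; rewrite /quadratic enorm_sqr -!EFinM -!EFinD lee_fin !dotE (dotC y x).
  lra.
Qed.

Lemma quadratic_subgradient x : subdifferential quadratic x (mu *: x).
Proof.
move=> y; rewrite /quadratic -EFinD lee_fin.
have := mulr_ge0 mu_ge0 (dot_ge0 (y - x)).
by rewrite !dotE (dotC y x); lra.
Qed.

Lemma quadratic_argmin : argmin quadratic 0.
Proof.
move=> y; rewrite /quadratic lee_fin dot0l mulr0.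
by rewrite mulr_ge0 ?divr_ge0 ?dot_ge0.
Qed.

(** The error is written as -(sigma mu / (1 + sigma)) w_(k+1), which equals
    (sigma / lambda) (w_(k+1) - w_k) for a positive step size and still makes
    sense when the step size is 0. *)
Lemma quadratic_iterates (lambda : nat -> R) (sigma : R) (w0 : 'rV[R]_d) :
  (forall k : nat, (1 <= k)%N -> 0 <= lambda k) -> 0 <= sigma ->
  inexact_prox_iterates quadratic lambda sigma w0 (fun n =>
    (\prod_(1 <= i < n.+1) ((1 + sigma) / (1 + sigma + lambda i * mu))) *: w0).
Proof.
move=> lambda_ge0 sigma_ge0; set w := (fun n : nat => _).
split; first by rewrite /w big_geq // scale1r.
exists (fun k => mu *: w k), (fun k => (- (sigma * mu / (1 + sigma))) *: w k).
move=> k; have lm_ge0 : 0 <= lambda k.+1 * mu by rewrite mulr_ge0 ?lambda_ge0.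
have s_gt0 : 0 < 1 + sigma by lra.
have den_gt0 : 0 < 1 + sigma + lambda k.+1 * mu by lra.
have wE : w k = (1 + lambda k.+1 * mu / (1 + sigma)) *: w k.+1.
  rewrite /w [in RHS]big_nat_recr //= scalerA; congr (_ *: _).
  by field; rewrite !gt_eqF.
split; first exact: quadratic_subgradient.
  rewrite wE; apply/rowP => i; rewrite !mxE.
  by field; rewrite gt_eqF.
rewrite !enorm_sqr wE; move: (w k.+1) => z; rewrite !dotE.
by rewrite le_eqVlt; apply/orP; left; apply/eqP; field; rewrite gt_eqF.
Qed.

End Quadratic.

(** * Convergence rate and tightness *)

Theorem theorem5p1 (R : realType) :
  (forall (d : nat) (mu : R) (h : 'rV[R]_d -> \bar R) (lambda : nat -> R)
      (sigma : R) (wstar w0 : 'rV[R]_d) (w : nat -> 'rV[R]_d) (N : nat),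
    0 <= mu ->
    Fclass mu h ->
    (forall k : nat, (1 <= k)%N -> 0 < lambda k) ->
    0 <= sigma <= 1 ->
    argmin h wstar ->
    (1 <= N)%N ->
    inexact_prox_iterates h lambda sigma w0 w ->
    (h (w N) - h wstar <= (rate mu sigma lambda N)%:E * (h w0 - h wstar))%E)
  /\
  (forall (mu : R) (lambda : nat -> R) (sigma : R) (d : nat)
      (w0 : 'rV[R]_d) (N : nat),
    0 <= mu ->
    (forall k : nat, (1 <= k)%N -> 0 <= lambda k) ->
    0 <= sigma <= 1 ->
    (1 <= d)%N ->
    (1 <= N)%N ->
    exists (h : 'rV[R]_d -> \bar R) (wstar : 'rV[R]_d) (w : nat -> 'rV[R]_d),
      [/\ Fclass mu h,
          argmin h wstar,
          inexact_prox_iterates h lambda sigma w0 w &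
          (h (w N) - h wstar = (rate mu sigma lambda N)%:E * (h w0 - h wstar))%E]).
Proof.
split.
  move=> d mu h lambda sigma ws w0 w N mu_ge0 [_ hproper hsc] lambda_gt0 sigma01.
  move=> hmin _ [<- [v [e step]]].
  elim: N => [|n IHn]; first by rewrite /rate big_geq // mul1e.
  have [hv wE err] := step n.
  apply: le_trans (prox_step mu_ge0 (lambda_gt0 _ _) sigma01 hproper hsc hmin
    hv wE err) _ => //.
  rewrite rateS (EFinM _ (rate _ _ _ _)) -muleA; apply: lee_wpmul2l => //.
  by rewrite lee_fin sqr_ge0.
move=> mu lambda sigma d w0 N mu_ge0 lambda_ge0 /andP[sigma_ge0 _] _ _.
exists (quadratic mu), 0; eexists; split.
- exact: quadratic_Fclass.
- exact: quadratic_argmin.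
- exact: quadratic_iterates.
- rewrite /quadratic -!EFinD -EFinM !dotE /rate prodrXl.
  by rewrite dot0l; congr (_%:E); ring.
Qed.
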